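(* Let $n\ge 1$, let $X$ be a topological space, and let $\gamma:[0,1]\to X$ be a path (continuous map) with $\gamma(0)=x$ and $\gamma(1)=y$. Then $\pi_n^{top}(X,x)\cong\pi_n^{top}(X,y)$, where $\cong$ denotes isomorphism of topological groups (a group isomorphism that is also a homeomorphism).
   Context: For a pointed space $(X,x)$ and $n\ge 1$, let $I=[0,1]$, let $\dot{I}^n$ be the boundary of $I^n$, and let $\mathrm{Hom}((I^n,\dot{I}^n),(X,x))$ be the set of continuous maps $f:I^n\to X$ with $f(\dot{I}^n)\subseteq\{x\}$ ($n$-loops at $x$), equipped with the compact-open topology, i.e. the topology with subbase the sets $\langle K,U\rangle=\{f : f(K)\subseteq U\}$, $K\subseteq I^n$ compact, $U\subseteq X$ open. Let $p_n:\mathrm{Hom}((I^n,\dot{I}^n),(X,x))\to\pi_n(X,x)$ be the surjection sending a map to its homotopy class relative to $\dot{I}^n$. $\pi_n^{top}(X,x)$ denotes the homotopy group $\pi_n(X,x)$, with its usual group operation induced by concatenation of $n$-loops (in the last coordinate), equipped with the quotient topology induced by $p_n$. *)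

(* Defs.v *)
From HB Require Import structures.
From mathcomp Require Import all_boot all_order all_algebra.
From mathcomp Require Import all_classical all_reals all_analysis.
From mathcomp Require Import generic_quotient ring lra.

Set Implicit Arguments.
Unset Strict Implicit.
Unset Printing Implicit Defensive.

Import Order.TTheory GRing.Theory Num.Theory.
Import numFieldNormedType.Exports.

Local Open Scope classical_set_scope.
Local Open Scope ring_scope.

Definition unit_itv (R : realType) : set R := `[0, 1].
Arguments unit_itv R : clear implicits.

Section clamp.
Context {R : realType}.
Implicit Types r : R.

Fact clamp_subproof r : Num.min 1 (Num.max 0 r) \in unit_itv R.
Proof.
apply/mem_set; rewrite /unit_itv /= in_itv /=.
by rewrite le_min ge_min le_max !lexx ler01.
Qed.

(* The retraction of R onto [0, 1]; concat_fun and reverse_fun only apply it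
   to numbers that already lie in [0, 1]. *)
Definition clamp r : unit_itv R :=
  exist (fun u => u \in unit_itv R) _ (clamp_subproof r).

Lemma itv01_ge0 (u : unit_itv R) : 0 <= \val u.
Proof. by case: u => r /= /set_mem; rewrite /unit_itv /= in_itv /= => /andP[]. Qed.

Lemma itv01_le1 (u : unit_itv R) : \val u <= 1.
Proof. by case: u => r /= /set_mem; rewrite /unit_itv /= in_itv /= => /andP[]. Qed.

Lemma clampE r : 0 <= r -> r <= 1 -> \val (clamp r) = r.
Proof. by move=> r0 r1; rewrite /= (max_idPr r0) (min_idPr r1). Qed.

Lemma clamp_le0 r : r <= 0 -> \val (clamp r) = 0.
Proof. by move=> r0; rewrite /= (max_idPl r0) (min_idPr _)// ler01. Qed.

Lemma clamp_ge1 r : 1 <= r -> \val (clamp r) = 1.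
Proof.
by move=> r1; rewrite /= (max_idPr (le_trans _ r1))// (min_idPl r1).
Qed.

Lemma clampK (u : unit_itv R) : clamp (\val u) = u.
Proof. by apply: val_inj; rewrite clampE ?itv01_ge0 ?itv01_le1. Qed.

Lemma clamp_continuous : continuous clamp.
Proof.
apply: continuous_comp_initial.
apply: (@min_fun_continuous _ R R (cst 1) (cst 0 \max id)).
  by move=> r; exact: cvg_cst.
apply: max_fun_continuous; first by move=> r; exact: cvg_cst.
by move=> r; exact: cvg_id.
Qed.

Lemma itv01_val_continuous : continuous (\val : unit_itv R -> R).
Proof. exact: initial_continuous. Qed.

End clamp.

Definition cube (R : realType) (n : nat) := {ptws 'I_n -> unit_itv R}.

Definition cube_boundary {R : realType} {n : nat} : set (cube R n) :=
  [set t | exists i : 'I_n, \val (t i) = 0 \/ \val (t i) = 1].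

Definition set_last {R : realType} {n : nat}
    (t : cube R n.+1) (u : unit_itv R) : cube R n.+1 :=
  fun i => if i == ord_max then u else t i.

Definition nloops (R : realType) (n : nat) {X : topologicalType} (x : X) :
    set {compact-open, cube R n -> X} :=
  [set f | continuous (f : cube R n -> X) /\
           forall t, cube_boundary t -> f t = x].

(* As the type of elements of a set, it carries the topology induced by the
   compact-open one. *)
Definition nloop (R : realType) (n : nat) {X : topologicalType} (x : X) :=
  set_type (@nloops R n X x).

Definition loop_fun (R : realType) (n : nat) (X : topologicalType) (x : X)
  (f : nloop R n x) : cube R n -> X := \val f.
Coercion loop_fun : nloop >-> Funclass.

Section loop_theory.
Context {R : realType} {n : nat} {X : topologicalType} {x : X}.
Implicit Types f g : nloop R n x.

Lemma loop_continuous f : continuous f.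
Proof. by have /set_mem[] := valP f. Qed.

Lemma loop_boundary f t : cube_boundary t -> f t = x.
Proof. by have /set_mem[_] := valP f; exact. Qed.

Definition mk_loop (F : cube R n -> X) (cF : continuous F)
    (bF : forall t, cube_boundary t -> F t = x) : nloop R n x :=
  exist (fun f : {compact-open, cube R n -> X} => f \in @nloops R n X x) F (mem_set (conj cF bF)).

Lemma eq_loop f g : f =1 g -> f = g.
Proof. by move=> fg; apply: val_inj; exact/funext. Qed.

Definition const_loop : nloop R n x :=
  @mk_loop (cst x) (@cst_continuous _ _ x) (fun _ _ => erefl).

Definition homotopic f g : Prop :=
  exists H : cube R n * unit_itv R -> X,
    [/\ continuous H,
        forall t, H (t, clamp 0) = f t,
        forall t, H (t, clamp 1) = g t &
        forall t s, cube_boundary t -> H (t, s) = x].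

End loop_theory.
Arguments const_loop {R n X} x.
Arguments loop_continuous {R n X x} f.
Arguments loop_boundary {R n X x} f [t].

Lemma comp_continuous {S T U : topologicalType} (f : S -> T) (g : T -> U) :
  continuous f -> continuous g -> continuous (fun p => g (f p)).
Proof. by move=> cf cg p; apply: continuous_comp; [exact: cf|exact: cg]. Qed.

Lemma pair_continuous {S T U : topologicalType} (f : S -> T) (g : S -> U) :
  continuous f -> continuous g -> continuous (fun p => (f p, g p)).
Proof. by move=> cf cg p; apply: cvg_pair; [exact: cf|exact: cg]. Qed.

Lemma fst_continuous {S T : topologicalType} :
  continuous (fst : S * T -> S).
Proof. by move=> p; exact: cvg_fst. Qed.

Lemma snd_continuous {S T : topologicalType} :
  continuous (snd : S * T -> T).
Proof. by move=> p; exact: cvg_snd. Qed.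

Lemma coord_continuous (R : realType) n (i : 'I_n) :
  continuous (fun t : cube R n => t i).
Proof. exact: (@proj_continuous 'I_n (fun=> set_type (unit_itv R)) i). Qed.

Section continuity.
Context {R : realType} {T X : topologicalType}.

Lemma paste_continuous (c : T -> R) (F G : T -> X) (a : R) :
  continuous c -> continuous F -> continuous G ->
  (forall p, c p = a -> F p = G p) ->
  continuous (fun p => if c p <= a then F p else G p).
Proof.
move=> cc cF cG FG; apply/continuous_subspace_setT.
have -> : [set: T] = [set p | c p <= a] `|` [set p | a <= c p].
  by apply/seteqP; split => // p _ /=; case: (leP (c p) a) => [|/ltW]; [left|right].
apply: withinU_continuous.
- exact: (closed_comp _ (@closed_le R a)).
- exact: (closed_comp _ (@closed_ge R a)).
- apply: (@subspace_eq_continuous _ _ _ F); last exact: continuous_subspaceT.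
  by move=> p /set_mem /= pa; rewrite /from_subspace pa.
- apply: (@subspace_eq_continuous _ _ _ G); last exact: continuous_subspaceT.
  move=> p /set_mem /= ap; rewrite /from_subspace; case: ifPn => // pa; apply/esym/FG.
  by apply/eqP; rewrite eq_le pa ap.
Qed.

Lemma cube_continuous n (f : T -> cube R n) :
  (forall i, continuous (fun p => f p i)) -> continuous f.
Proof.
move=> cf p; apply/cvg_sup => i; apply: continuous_comp_initial => //.
exact: cf.
Qed.

Lemma set_last_continuous n (a : T -> cube R n.+1) (b : T -> unit_itv R) :
  continuous a -> continuous b -> continuous (fun p => set_last (a p) (b p)).
Proof.
move=> ca cb; apply: cube_continuous => i; rewrite /set_last.
case: (i == ord_max) => //.
exact: (comp_continuous ca (@coord_continuous R _ i)).
Qed.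

End continuity.

Section set_last_theory.
Context {R : realType} {n : nat}.
Implicit Types (t : cube R n.+1) (u v : unit_itv R).

Lemma set_last_last t u : set_last t u ord_max = u.
Proof. by rewrite /set_last eqxx. Qed.

Lemma set_lastK t u v : set_last (set_last t u) v = set_last t v.
Proof. by apply/funext => i; rewrite /set_last; case: (i == ord_max). Qed.

Lemma set_last_id t : set_last t (t ord_max) = t.
Proof. by apply/funext => i; rewrite /set_last; have [->|] := eqVneq i ord_max. Qed.

Lemma set_last_boundary1 t u :
  \val u = 0 \/ \val u = 1 -> cube_boundary (set_last t u).
Proof. by move=> u01; exists ord_max; rewrite set_last_last. Qed.

Lemma set_last_boundary t u : cube_boundary t ->
  \val (t ord_max) = 0 \/ \val (t ord_max) = 1 \/ cube_boundary (set_last t u).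
Proof.
case=> i; have [->|inm] := eqVneq i ord_max; first by case; [left|right; left].
by move=> ti; right; right; exists i; rewrite /set_last (negPf inm).
Qed.

End set_last_theory.

Section concatenation.
Context {R : realType} {n : nat} {X : topologicalType}.
Implicit Types F G : cube R n.+1 -> X.

Definition concat_fun F G (t : cube R n.+1) : X :=
  let u : R := \val (t ord_max) in
  if u <= 2^-1 then F (set_last t (clamp (2 * u)))
  else G (set_last t (clamp (2 * u - 1))).

Lemma last_continuous (T : topologicalType) (a : T -> cube R n.+1) :
  continuous a -> continuous (fun p => \val (a p ord_max) : R).
Proof.
move=> ca; apply: comp_continuous itv01_val_continuous.
exact: (comp_continuous ca (@coord_continuous R _ ord_max)).
Qed.

Lemma concat_fun_continuous (T : topologicalType) (a : T -> cube R n.+1)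
    (F G : T -> cube R n.+1 -> X) (x : X) :
  (forall b : T -> cube R n.+1, continuous b -> continuous (fun p => F p (b p))) ->
  (forall b : T -> cube R n.+1, continuous b -> continuous (fun p => G p (b p))) ->
  (forall p t, cube_boundary t -> F p t = x) ->
  (forall p t, cube_boundary t -> G p t = x) ->
  continuous a -> continuous (fun p => concat_fun (F p) (G p) (a p)).
Proof.
move=> cF cG bF bG ca; have cu := last_continuous ca.
apply: paste_continuous => //.
- apply: cF; apply: set_last_continuous => //.
  apply: comp_continuous clamp_continuous => p.
  by apply: cvgM; [exact: cvg_cst|exact: cu].
- apply: cG; apply: set_last_continuous => //.
  apply: comp_continuous clamp_continuous => p.
  apply: cvgB; last exact: cvg_cst.
  by apply: cvgM; [exact: cvg_cst|exact: cu].
- move=> p /= ->; rewrite bF ?bG//.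
  + by apply: set_last_boundary1; left; rewrite clamp_le0//; lra.
  + by apply: set_last_boundary1; right; rewrite clamp_ge1//; lra.
Qed.

Lemma concat_fun_boundary F G (x : X) :
  (forall t, cube_boundary t -> F t = x) ->
  (forall t, cube_boundary t -> G t = x) ->
  forall t, cube_boundary t -> concat_fun F G t = x.
Proof.
move=> bF bG t bt; rewrite /concat_fun /=; case: ifPn => h.
  apply: bF; have [t0|[t1|//]] := set_last_boundary (clamp (2 * \val (t ord_max))) bt.
    by apply: set_last_boundary1; left; rewrite clamp_le0// t0; lra.
  by exfalso; move: h; rewrite t1; lra.
apply: bG; have [t0|[t1|//]] := set_last_boundary (clamp (2 * \val (t ord_max) - 1)) bt.
  by exfalso; move: h; rewrite t0; lra.
by apply: set_last_boundary1; right; rewrite clamp_ge1// t1; lra.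
Qed.

Context {x : X}.

Lemma concat_continuous (f g : nloop R n.+1 x) : continuous (concat_fun f g).
Proof.
apply: (@concat_fun_continuous _ id (fun=> f) (fun=> g) x).
- by move=> b cb; exact: comp_continuous cb (loop_continuous f).
- by move=> b cb; exact: comp_continuous cb (loop_continuous g).
- by move=> _; exact: loop_boundary.
- by move=> _; exact: loop_boundary.
- by move=> t; exact: cvg_id.
Qed.

Definition concat (f g : nloop R n.+1 x) : nloop R n.+1 x :=
  mk_loop (@concat_continuous f g)
    (concat_fun_boundary (loop_boundary f) (loop_boundary g)).

Definition reverse_fun (f : nloop R n.+1 x) (t : cube R n.+1) : X :=
  f (set_last t (clamp (1 - \val (t ord_max)))).

Lemma reverse_continuous (f : nloop R n.+1 x) : continuous (reverse_fun f).
Proof.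
apply: comp_continuous (loop_continuous f); apply: set_last_continuous.
  by move=> t; exact: cvg_id.
apply: comp_continuous clamp_continuous.
apply: (@comp_continuous _ R R _ (fun u => 1 - u)).
  by apply: (@last_continuous _ id) => t; exact: cvg_id.
by move=> u; apply: cvgB; [exact: cvg_cst|exact: cvg_id].
Qed.

Lemma reverse_boundary (f : nloop R n.+1 x) t :
  cube_boundary t -> reverse_fun f t = x.
Proof.
move=> bt; apply: loop_boundary.
have [t0|[t1|//]] := set_last_boundary (clamp (1 - \val (t ord_max))) bt.
  by apply: set_last_boundary1; right; rewrite clamp_ge1// t0; lra.
by apply: set_last_boundary1; left; rewrite clamp_le0// t1; lra.
Qed.

Definition reverse (f : nloop R n.+1 x) : nloop R n.+1 x :=
  mk_loop (@reverse_continuous f) (@reverse_boundary f).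

End concatenation.

Section homotopy_relation.
Context {R : realType} {n : nat} {X : topologicalType} {x : X}.
Implicit Types f g h : nloop R n x.

Lemma homotopic_refl f : homotopic f f.
Proof.
exists (fun p => f p.1); split => // [|t s]; last exact: loop_boundary.
exact: comp_continuous fst_continuous (loop_continuous f).
Qed.

Lemma homotopic_sym f g : homotopic f g -> homotopic g f.
Proof.
case=> H [cH H0 H1 Hb].
exists (fun p => H (p.1, clamp (1 - \val p.2))); split => [|t|t|t s].
- apply: comp_continuous cH ; apply: (pair_continuous fst_continuous).
  apply: (comp_continuous _ clamp_continuous).
  apply: (@comp_continuous _ R R _ (fun u => 1 - u)).
    exact: comp_continuous snd_continuous itv01_val_continuous.
  by move=> u; apply: cvgB; [exact: cvg_cst|exact: cvg_id].
- by rewrite -H1; cbn [fst snd]; rewrite (clamp_le0 (lexx 0)) subr0.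
- by rewrite -H0; cbn [fst snd]; rewrite (clamp_ge1 (lexx 1)) subrr.
- exact: Hb.
Qed.

Lemma homotopic_trans g f h : homotopic f g -> homotopic g h -> homotopic f h.
Proof.
case=> H [cH H0 H1 Hb] [K [cK K0 K1 Kb]].
have cs : continuous (fun p : cube R n * unit_itv R => \val p.2 : R).
  exact: comp_continuous snd_continuous itv01_val_continuous.
exists (fun p => if \val p.2 <= 2^-1 then H (p.1, clamp (2 * \val p.2))
                 else K (p.1, clamp (2 * \val p.2 - 1))); split.
- apply: paste_continuous => //.
  + apply: comp_continuous cH ; apply: (pair_continuous fst_continuous).
    apply: (comp_continuous _ clamp_continuous).
    apply: (@comp_continuous _ R R _ (fun u => 2 * u)) => //.
    by move=> u; apply: cvgM; [exact: cvg_cst|exact: cvg_id].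
  + apply: comp_continuous cK ; apply: (pair_continuous fst_continuous).
    apply: (comp_continuous _ clamp_continuous).
    apply: (@comp_continuous _ R R _ (fun u => 2 * u - 1)) => //.
    move=> u; apply: cvgB; last exact: cvg_cst.
    by apply: cvgM; [exact: cvg_cst|exact: cvg_id].
  + by move=> p ->; rewrite mulfV// subrr H1 K0.
- by move=> t; cbn [fst snd]; rewrite (clamp_le0 (lexx 0)) mulr0 invr_ge0 ler0n H0.
- move=> t; cbn [fst snd]; rewrite (clamp_ge1 (lexx 1)) ifF; last by apply/negbTE; lra.
  by rewrite (_ : 2 * 1 - 1 = 1) ?K1//; lra.
- by move=> t s bt; case: ifP => _; [exact: Hb|exact: Kb].
Qed.

Definition homotopic_rel : rel (nloop R n x) := fun f g => `[< homotopic f g >].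

Lemma homotopic_rel_refl : reflexive homotopic_rel.
Proof. by move=> f; apply/asboolP; exact: homotopic_refl. Qed.

Lemma homotopic_rel_sym : symmetric homotopic_rel.
Proof. by move=> f g; apply/asboolP/asboolP; exact: homotopic_sym. Qed.

Lemma homotopic_rel_trans : transitive homotopic_rel.
Proof.
move=> g f h /asboolP fg /asboolP gh; apply/asboolP.
exact: homotopic_trans fg gh.
Qed.

Canonical homotopic_equiv :=
  EquivRel homotopic_rel homotopic_rel_refl homotopic_rel_sym homotopic_rel_trans.

End homotopy_relation.

Local Ltac minmax := rewrite /=; repeat match goal with
  | |- context [Order.min ?a ?b] =>
    lazymatch b with context [Order.min] => fail | _ => case: (leP a b) => ? end
  | |- context [Order.max ?a ?b] => case: (leP a b) => ?
  end; lra.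

Section homotopy_group_laws.
Context {R : realType} {n : nat} {X : topologicalType} {x : X}.
Implicit Types (f g h : nloop R n.+1 x) (t : cube R n.+1) (r : R).

Lemma concat_lo f g t r : 0 <= r -> r <= 2^-1 ->
  concat f g (set_last t (clamp r)) = f (set_last t (clamp (2 * r))).
Proof.
move=> r0 r1; rewrite /concat /loop_fun /= -/(loop_fun f) -/(loop_fun g).
rewrite /concat_fun set_last_last clampE//; last by lra.
by rewrite r1 set_lastK.
Qed.

Lemma concat_hi f g t r : 2^-1 <= r -> r <= 1 ->
  concat f g (set_last t (clamp r)) = g (set_last t (clamp (2 * r - 1))).
Proof.
move=> r0 r1; rewrite /concat /loop_fun /= -/(loop_fun f) -/(loop_fun g).
rewrite /concat_fun set_last_last clampE//; last by lra.
rewrite !set_lastK; case: ifPn => // r2.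
have -> : r = 2^-1 by apply/eqP; rewrite eq_le r0 r2.
rewrite !loop_boundary//; apply: set_last_boundary1.
- by left; rewrite clamp_le0//; lra.
- by right; rewrite clamp_ge1//; lra.
Qed.

Lemma reverseE f t r : 0 <= r -> r <= 1 ->
  reverse f (set_last t (clamp r)) = f (set_last t (clamp (1 - r))).
Proof.
move=> r0 r1; rewrite /reverse {1}/loop_fun /= /reverse_fun.
by rewrite set_last_last clampE// set_lastK.
Qed.

Lemma loop_le0 f t r : r <= 0 -> f (set_last t (clamp r)) = x.
Proof.
by move=> r0; apply/loop_boundary/set_last_boundary1; left; exact: clamp_le0.
Qed.

Lemma loop_ge1 f t r : 1 <= r -> f (set_last t (clamp r)) = x.
Proof.
by move=> r0; apply/loop_boundary/set_last_boundary1; right; exact: clamp_ge1.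
Qed.

Lemma reverseK : involutive (@reverse R n X x).
Proof.
move=> f; apply: eq_loop => t; rewrite -[t]set_last_id -[t ord_max]clampK.
have := itv01_ge0 (t ord_max); have := itv01_le1 (t ord_max).
move: (\val (t ord_max)) => r r1 r0.
rewrite !reverseE//; [|lra|lra].
by congr (f (set_last _ (clamp _))); lra.
Qed.

Lemma homotopic_reparam f g h (a b : R -> R) :
  continuous a -> continuous b ->
  a 0 = b 0 -> a 1 = b 1 -> (a 0 = 0 \/ a 0 = 1) -> (a 1 = 0 \/ a 1 = 1) ->
  (forall t r, 0 <= r -> r <= 1 ->
    g (set_last t (clamp r)) = f (set_last t (clamp (a r)))) ->
  (forall t r, 0 <= r -> r <= 1 ->
    h (set_last t (clamp r)) = f (set_last t (clamp (b r)))) ->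
  homotopic g h.
Proof.
move=> ca cb ab0 ab1 a0 a1 gE hE.
exists (fun p => f (set_last p.1 (clamp
  (a (\val (p.1 ord_max)) +
   \val p.2 * (b (\val (p.1 ord_max)) - a (\val (p.1 ord_max))))))).
split.
- apply: comp_continuous (loop_continuous f).
  apply: (set_last_continuous fst_continuous).
  apply: (comp_continuous _ clamp_continuous).
  have cl := last_continuous (@fst_continuous (cube R n.+1) (unit_itv R)).
  have cs : continuous (fun p : cube R n.+1 * unit_itv R => \val p.2 : R).
    exact: comp_continuous snd_continuous itv01_val_continuous.
  apply: (@comp_continuous _ (R * R)%type R
     (fun p : cube R n.+1 * unit_itv R => (\val (p.1 ord_max), \val p.2))
     (fun q => a q.1 + q.2 * (b q.1 - a q.1))); first exact: pair_continuous.
  have cau := comp_continuous (@fst_continuous R R) ca.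
  have cbu := comp_continuous (@fst_continuous R R) cb.
  move=> q; apply: cvgD; first exact: cau.
  apply: cvgM; first exact: snd_continuous.
  by apply: cvgB; [exact: cbu|exact: cau].
- move=> t; cbn [fst snd]; rewrite (clamp_le0 (lexx 0)) mul0r addr0.
  rewrite -gE ?itv01_ge0 ?itv01_le1//.
  by rewrite clampK set_last_id.
- move=> t; cbn [fst snd]; rewrite (clamp_ge1 (lexx 1)) mul1r addrC subrK.
  rewrite -hE ?itv01_ge0 ?itv01_le1//.
  by rewrite clampK set_last_id.
- move=> t s bt; cbn [fst snd].
  set c := clamp _; have [t0|[t1|bt']] := set_last_boundary c bt.
  + rewrite {}/c t0 -ab0 subrr mulr0 addr0.
    by case: a0 => ->; [rewrite loop_le0|rewrite loop_ge1].
  + rewrite {}/c t1 -ab1 subrr mulr0 addr0.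
    by case: a1 => ->; [rewrite loop_le0|rewrite loop_ge1].
  + exact: loop_boundary.
Qed.

Lemma concat_homotopic f f' g g' :
  homotopic f f' -> homotopic g g' -> homotopic (concat f g) (concat f' g').
Proof.
case=> H [cH H0 H1 Hb] [K [cK K0 K1 Kb]].
exists (fun p => concat_fun (fun t => H (t, p.2)) (fun t => K (t, p.2)) p.1).
split.
- apply: (@concat_fun_continuous _ _ _ _ _
    (fun p t => H (t, p.2)) (fun p t => K (t, p.2)) x) => //.
  + move=> b cb; apply: comp_continuous cH.
    exact: pair_continuous cb snd_continuous.
  + move=> b cb; apply: comp_continuous cK.
    exact: pair_continuous cb snd_continuous.
  + by move=> p t; exact: Hb.
  + by move=> p t; exact: Kb.
  + exact: fst_continuous.
- by move=> t; cbn [fst snd]; congr concat_fun; apply/funext => s.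
- by move=> t; cbn [fst snd]; congr concat_fun; apply/funext => s.
- move=> t s bt; cbn [fst snd].
  by apply: concat_fun_boundary bt => t' bt'; [exact: Hb|exact: Kb].
Qed.

Let affine_continuous (a b : R) : continuous (fun u : R => a * u + b).
Proof.
move=> u; apply: cvgD; last exact: cvg_cst.
by apply: cvgM; [exact: cvg_cst|exact: cvg_id].
Qed.

Let id_continuous : continuous (id : R -> R).
Proof. by move=> u; exact: cvg_id. Qed.

Lemma homotopic_concatA f g h :
  homotopic (concat f (concat g h)) (concat (concat f g) h).
Proof.
apply: homotopic_sym.
apply: (@homotopic_reparam (concat f (concat g h)) _ _ ((fun u => 2 * u + 0) \min
   ((fun u => 1 * u + 4^-1) \min (fun u => 2^-1 * u + 2^-1))) id) => //.
- apply: min_fun_continuous; first exact: affine_continuous.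
  by apply: min_fun_continuous; exact: affine_continuous.
- by minmax.
- by minmax.
- by left; minmax.
- by right; minmax.
move=> t r r0 r1; set m := (X in _ = loop_fun _ (set_last t (clamp X))).
have [rl|rl] := leP r 2^-1.
  have [rl'|rl'] := leP r 4^-1.
    have -> : m = 2 * r.
      by rewrite /m; minmax.
    rewrite concat_lo// concat_lo; [|lra|lra].
    by rewrite concat_lo//; lra.
  have -> : m = r + 4^-1.
    by rewrite /m; minmax.
  rewrite concat_lo// concat_hi; [|lra|lra].
  rewrite concat_hi; [|lra|lra].
  rewrite concat_lo; [|lra|lra].
  by congr (g (set_last _ (clamp _))); lra.
have -> : m = 2^-1 * r + 2^-1.
  by rewrite /m; minmax.
rewrite concat_hi; [|lra|lra].
rewrite concat_hi; [|lra|lra].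
rewrite concat_hi; [|lra|lra].
by congr (h (set_last _ (clamp _))); lra.
Qed.

Lemma homotopic_concat1l f : homotopic (concat (const_loop x) f) f.
Proof.
apply: (@homotopic_reparam f _ _ (cst 0 \max (fun u => 2 * u + (-1))) id) => //.
- apply: max_fun_continuous; last exact: affine_continuous.
  by move=> u; exact: cvg_cst.
- by minmax.
- by minmax.
- by left; minmax.
- by right; minmax.
move=> t r r0 r1; have [rl|rl] := leP r 2^-1.
  by rewrite concat_lo// [RHS]loop_le0//; minmax.
rewrite concat_hi; [|lra|lra].
congr (f (set_last _ (clamp _))).
by minmax.
Qed.

Lemma homotopic_concat1r f : homotopic (concat f (const_loop x)) f.
Proof.
apply: (@homotopic_reparam f _ _ (cst 1 \min (fun u => 2 * u + 0)) id) => //.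
- apply: min_fun_continuous; last exact: affine_continuous.
  by move=> u; exact: cvg_cst.
- by minmax.
- by minmax.
- by left; minmax.
- by right; minmax.
move=> t r r0 r1; have [rl|rl] := leP r 2^-1.
  rewrite concat_lo//; congr (f (set_last _ (clamp _))).
  by minmax.
rewrite concat_hi; [|lra|lra].
by rewrite [RHS]loop_ge1//; minmax.
Qed.

Lemma homotopic_reverser f : homotopic (concat f (reverse f)) (const_loop x).
Proof.
apply: (@homotopic_reparam f _ _
  ((fun u => 2 * u + 0) \min (fun u => - 2 * u + 2)) (cst 0)) => //.
- by apply: min_fun_continuous; exact: affine_continuous.
- by move=> u; exact: cvg_cst.
- by minmax.
- by minmax.
- by left; minmax.
- by left; minmax.
- move=> t r r0 r1; have [rl|rl] := leP r 2^-1.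
    rewrite concat_lo//; congr (f (set_last _ (clamp _))).
    by minmax.
  rewrite concat_hi; [|lra|lra].
  rewrite reverseE; [|lra|lra].
  congr (f (set_last _ (clamp _))).
  by minmax.
- by move=> t r r0 r1; rewrite [RHS]loop_le0.
Qed.

Lemma homotopic_reversel f : homotopic (concat (reverse f) f) (const_loop x).
Proof. by rewrite -{2}[f]reverseK; exact: homotopic_reverser. Qed.

Lemma reverse_homotopic f g : homotopic f g -> homotopic (reverse f) (reverse g).
Proof.
move=> fg; apply: homotopic_trans (homotopic_concat1r _).
apply: homotopic_trans (homotopic_sym (homotopic_concat1r _)) _.
have := homotopic_sym (homotopic_reverser g) => gg.
apply: homotopic_trans (concat_homotopic (homotopic_refl _) gg) _.
apply: homotopic_trans (homotopic_concatA _ _ _) _.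
apply: homotopic_trans (concat_homotopic
  (concat_homotopic (homotopic_refl _) (homotopic_sym fg)) (homotopic_refl _)) _.
apply: homotopic_trans (concat_homotopic (homotopic_reversel _) (homotopic_refl _)) _.
apply: homotopic_trans (homotopic_concat1l _) _.
exact: homotopic_sym (homotopic_concat1r _).
Qed.

End homotopy_group_laws.

Local Open Scope quotient_scope.

Definition homotopy_group (R : realType) (n : nat) {X : topologicalType}
    (x : X) :=
  quotient_topology {eq_quot (@homotopic_equiv R n X x)}.

Section homotopy_group.
Context {R : realType} {n : nat} {X : topologicalType} {x : X}.
Local Notation loops := (nloop R n.+1 x).
Local Notation PI := (homotopy_group R n.+1 x).

Definition homotopy_class (f : loops) : PI := \pi_PI f.

Lemma homotopy_classP (f g : loops) :
  homotopy_class f = homotopy_class g <-> homotopic f g.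
Proof. by split => [/eqmodP/asboolP//|fg]; apply/eqmodP/asboolP. Qed.

Lemma repr_homotopic (f : loops) : homotopic (repr (homotopy_class f)) f.
Proof. by apply/homotopy_classP; rewrite /homotopy_class reprK. Qed.

Definition homotopy_one : PI := homotopy_class (const_loop x).

Definition homotopy_mul (a b : PI) : PI :=
  homotopy_class (concat (repr a) (repr b)).

Definition homotopy_inv (a : PI) : PI := homotopy_class (reverse (repr a)).

Lemma homotopy_mulE (f g : loops) :
  homotopy_mul (homotopy_class f) (homotopy_class g) =
  homotopy_class (concat f g).
Proof.
by apply/homotopy_classP/concat_homotopic; exact: repr_homotopic.
Qed.

Lemma homotopy_invE (f : loops) :
  homotopy_inv (homotopy_class f) = homotopy_class (reverse f).
Proof. exact/homotopy_classP/reverse_homotopic/repr_homotopic. Qed.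

Lemma homotopy_class_ind (P : PI -> Prop) :
  (forall f, P (homotopy_class f)) -> forall a, P a.
Proof. by move=> Pf a; rewrite -[a]reprK; exact: Pf. Qed.

Lemma homotopy_mulA : associative homotopy_mul.
Proof.
elim/homotopy_class_ind => f; elim/homotopy_class_ind => g.
elim/homotopy_class_ind => h; rewrite !homotopy_mulE.
exact/homotopy_classP/homotopic_concatA.
Qed.

Lemma homotopy_mul1 : left_id homotopy_one homotopy_mul.
Proof.
elim/homotopy_class_ind => f; rewrite homotopy_mulE.
exact/homotopy_classP/homotopic_concat1l.
Qed.

Lemma homotopy_mulr1 : right_id homotopy_one homotopy_mul.
Proof.
elim/homotopy_class_ind => f; rewrite homotopy_mulE.
exact/homotopy_classP/homotopic_concat1r.
Qed.

Lemma homotopy_mulV : left_inverse homotopy_one homotopy_inv homotopy_mul.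
Proof.
elim/homotopy_class_ind => f; rewrite homotopy_invE homotopy_mulE.
exact/homotopy_classP/homotopic_reversel.
Qed.

Lemma homotopy_mulrV : right_inverse homotopy_one homotopy_inv homotopy_mul.
Proof.
elim/homotopy_class_ind => f; rewrite homotopy_invE homotopy_mulE.
exact/homotopy_classP/homotopic_reverser.
Qed.

End homotopy_group.

HB.instance Definition _ (R : realType) (n : nat) (X : topologicalType)
    (x : X) := Topological.on (homotopy_group R n x).

HB.instance Definition _ (R : realType) (n : nat) (X : topologicalType)
    (x : X) :=
  isGroup.Build (homotopy_group R n.+1 x) homotopy_mulA homotopy_mul1
    homotopy_mulr1 homotopy_mulV homotopy_mulrV.

(* Main.v *)
Require Import Defs.
From mathcomp Require Import all_boot all_order all_algebra.
From mathcomp Require Import all_classical all_reals all_analysis.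
From mathcomp Require Import generic_quotient lra.

Set Implicit Arguments.
Unset Strict Implicit.
Unset Printing Implicit Defensive.

Import Order.TTheory GRing.Theory Num.Theory.
Import numFieldNormedType.Exports.

Local Open Scope classical_set_scope.
Local Open Scope ring_scope.

(** Given a path [g] from [x] to [y], a loop [f] at [x] is moved to a loop
    [transport g f] at [y] by running [f] on the concentric cube of half the
    size and [g] along every radius of the remaining collar.  On homotopy
    classes this is the classical change of basepoint; the point is that it is
    also continuous.

    Continuity holds already for the loop spaces ([transport_continuous]): for
    [K] compact and [U] open, [transport g f] maps [K] into [U] as soon as [g]
    does so on the part of [K] lying in the collar, a condition that does not
    involve [f], and [f] maps into [U] the rescaled part of [K] lying in the
    inner cube, which is again compact.  The universal property of the quotient
    topology then gives continuity on the homotopy groups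
    ([base_change_continuous]).

    All the algebra follows from a characterisation of [transport g f] up to
    homotopy: it is the only class of loops at [y] that [f] reaches by a
    homotopy whose restriction to the boundary of the cube runs along [g].
    Existence is [homotopic_along_transport] and uniqueness is
    [homotopic_transport].  Homotopies along [g] can be concatenated, so
    transport is a morphism ([base_changeM]), and run backwards, so transport
    along the reversed path is the inverse ([base_changeK]).  The classical
    explicit homotopies between nested collars are thereby avoided. *)

(** * The collar of the cube *)

Section collar.
Context {R : realType} {n : nat}.
Implicit Types (t : cube R n) (k : R).

(** The sup-norm distance of [t] to the centre of the cube, normalised to be
    [1] exactly on the boundary. *)
Definition center_dist t : R := \big[Num.max/0]_(i < n) `|2 * \val (t i) - 1|.

(** The homothety of ratio [k] about the centre of the cube; points that would
    leave the cube are pushed back onto its boundary, which makes the map total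
    and continuous. *)
Definition stretch k t : cube R n :=
  fun i => clamp (2^-1 + k * (\val (t i) - 2^-1)).

Lemma val_continuous {T : topologicalType} (a : T -> cube R n) (i : 'I_n) :
  continuous a -> continuous (fun p => \val (a p i) : R).
Proof.
move=> ca; apply: comp_continuous itv01_val_continuous.
exact: (comp_continuous ca (@Defs.coord_continuous R _ i)).
Qed.

Lemma center_dist_continuous : continuous center_dist.
Proof.
pose F (i : 'I_n) (t : cube R n) : R := `|2 * \val (t i) - 1|.
(* Unfolding continuity beta-reduces the value at a point, so that a named
   function [G] is rewritten instead of the maximum itself. *)
have big_continuous s G :
    G = (fun t => \big[Num.max/0]_(i <- s) F i t) -> continuous G.
  elim: s G => [|i s IHs] G GE.
    have -> : G = cst 0 by rewrite GE; apply/funext => t; rewrite big_nil.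
    exact: cst_continuous.
  have -> : G = F i \max (fun t => \big[Num.max/0]_(i <- s) F i t).
    by rewrite GE; apply/funext => t; rewrite big_cons.
  apply: max_fun_continuous (IHs _ erefl).
  apply: (@comp_continuous _ R R _ (fun r => `|2 * r - 1|)).
    by apply: (@val_continuous _ id) => t; exact: cvg_id.
  move=> r; apply: cvg_norm; apply: cvgB; last exact: cvg_cst.
  by apply: cvgM; [exact: cvg_cst|exact: cvg_id].
exact: big_continuous erefl.
Qed.

Lemma stretch_continuous {T : topologicalType} (k : T -> R) (a : T -> cube R n) :
  continuous k -> continuous a -> continuous (fun p => stretch (k p) (a p)).
Proof.
move=> ck ca; apply: cube_continuous => i.
apply: comp_continuous clamp_continuous => p.
apply: cvgD; first exact: cvg_cst.
apply: cvgM; first exact: ck.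
by apply: cvgB; [exact: val_continuous|exact: cvg_cst].
Qed.

Lemma center_dist_le1 t : center_dist t <= 1.
Proof.
apply: bigmax_le => // i _; have := itv01_ge0 (t i); have := itv01_le1 (t i).
by rewrite ler_norml => ? ?; apply/andP; split; lra.
Qed.

Lemma center_dist_boundary t : cube_boundary t -> center_dist t = 1.
Proof.
move=> [i ti]; apply/eqP; rewrite eq_le center_dist_le1.
have <- : `|2 * \val (t i) - 1| = 1 :> R.
  case: ti => ->; first by rewrite mulr0 sub0r normrN1.
  by rewrite (_ : 2 * 1 - 1 = 1 :> R) ?normr1//; lra.
exact: (le_bigmax _ (fun i => `|2 * \val (t i) - 1|)).
Qed.

Lemma stretch1 t : stretch 1 t = t.
Proof. by apply/funext => i; rewrite /stretch mul1r subrKC clampK. Qed.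

(** A coordinate that realises the maximal distance to the centre is sent to an
    end of the interval. *)
Lemma stretch_boundary k t :
  0 < k -> 1 <= k * center_dist t -> cube_boundary (stretch k t).
Proof.
move=> k0 kt; apply: contrapT => nb; move: kt; apply/negP; rewrite -ltNge.
rewrite mulrC -ltr_pdivlMr// div1r; apply: bigmax_lt => [|i _].
  by rewrite invr_gt0.
rewrite -div1r ltr_pdivlMr// ltNge; apply/negP => kt; apply: nb; exists i.
rewrite /stretch; set r := \val (t i) in kt *.
have [r0|r0] := leP 0 (2 * r - 1).
  by right; apply: clamp_ge1; move: kt; rewrite ger0_norm//; nra.
by left; apply: clamp_le0; move: kt; rewrite ltr0_norm//; nra.
Qed.

(** The map that runs [F] on the concentric cube of side [1 / k] and the path
    [d] radially in the collar around it. *)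
Definition collar {X : Type} k (F : cube R n -> X) (d : unit_itv R -> X) t : X :=
  if k * center_dist t <= 1 then F (stretch k t)
  else d (clamp (k * center_dist t - 1)).

Lemma collar1 {X : Type} (F : cube R n -> X) d : collar 1 F d = F.
Proof. by apply/funext => t; rewrite /collar mul1r center_dist_le1 stretch1. Qed.

(** For [k = 1] the boundary is still in the inner cube, where only the
    agreement of [F] with the start of [d] gives the value. *)
Lemma collar_boundary {X : Type} k (F : cube R n -> X) d t :
  1 <= k -> (forall t, cube_boundary t -> F t = d (clamp 0)) ->
  cube_boundary t -> collar k F d t = d (clamp (k - 1)).
Proof.
move=> k1 Fd bt; rewrite /collar (center_dist_boundary bt) mulr1.
case: ifPn => // kle1; have -> : k = 1 by apply/eqP; rewrite eq_le kle1 k1.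
by rewrite stretch1 Fd// subrr.
Qed.

(** Everything depends on a parameter, so that the same lemma gives the
    continuity of a single collared loop and of a homotopy of such.  The two
    pieces agree where they meet because the inner cube is stretched onto the
    whole cube, so that its boundary lands where [F] is the start of [d]. *)
Lemma collar_continuous {T X : topologicalType} (k : T -> R)
    (F : T -> cube R n -> X) (d : T -> unit_itv R -> X) (a : T -> cube R n) :
  continuous k -> (forall p, 0 < k p) ->
  (forall b : T -> cube R n, continuous b -> continuous (fun p => F p (b p))) ->
  (forall b : T -> unit_itv R, continuous b -> continuous (fun p => d p (b p))) ->
  (forall p t, cube_boundary t -> F p t = d p (clamp 0)) ->
  continuous a -> continuous (fun p => collar (k p) (F p) (d p) (a p)).
Proof.
move=> ck k0 cF cd Fd ca.
have ckr : continuous (fun p => k p * center_dist (a p)).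
  move=> p; apply: cvgM; first exact: ck.
  exact: (comp_continuous ca center_dist_continuous).
apply: paste_continuous => //.
- exact/cF/stretch_continuous.
- apply: cd; apply: comp_continuous clamp_continuous => p.
  by apply: cvgB; [exact: ckr|exact: cvg_cst].
- by move=> p kr; rewrite kr subrr Fd//; apply: stretch_boundary; rewrite ?kr.
Qed.

End collar.

(** * Transport of loops along a path *)

Record unit_path (R : realType) (X : topologicalType) (x y : X) := UnitPath {
  path_fun :> unit_itv R -> X;
  path_continuous : continuous path_fun;
  path0 : path_fun (clamp 0) = x;
  path1 : path_fun (clamp 1) = y }.

Section paths.
Context {R : realType} {X : topologicalType}.

Definition path_const (x : X) : unit_path R x x :=
  UnitPath (@cst_continuous _ _ x) erefl erefl.

Context {x y : X}.

Definition flip (u : unit_itv R) : unit_itv R := clamp (1 - \val u).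

Lemma flip_continuous : continuous flip.
Proof.
apply: (comp_continuous _ clamp_continuous).
apply: (@comp_continuous _ R R _ (fun r => 1 - r)).
  exact: itv01_val_continuous.
by move=> u; apply: cvgB; [exact: cvg_cst|exact: cvg_id].
Qed.

Lemma flip0 : flip (clamp 0) = clamp 1.
Proof. by rewrite /flip (clamp_le0 (lexx 0)) subr0. Qed.

Lemma flip1 : flip (clamp 1) = clamp 0.
Proof. by rewrite /flip (clamp_ge1 (lexx 1)) subrr. Qed.

Lemma flipK : involutive flip.
Proof.
move=> u; have u0 := itv01_ge0 u; have u1 := itv01_le1 u.
rewrite /flip clampE; [|lra|lra].
by rewrite opprB addrC subrK clampK.
Qed.

Lemma path_rev_subproof (g : unit_path R x y) :
  [/\ continuous (g \o flip), (g \o flip) (clamp 0) = y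
    & (g \o flip) (clamp 1) = x].
Proof.
split; last by rewrite /= flip1 path0.
- exact: (comp_continuous flip_continuous (@path_continuous _ _ _ _ g)).
- by rewrite /= flip0 path1.
Qed.

Definition path_rev (g : unit_path R x y) : unit_path R y x :=
  let: And3 c h0 h1 := path_rev_subproof g in UnitPath c h0 h1.

Lemma path_revE (g : unit_path R x y) u : path_rev g u = g (flip u).
Proof. by rewrite /path_rev; case: path_rev_subproof. Qed.

End paths.

Section transport.
Context {R : realType} {n : nat} {X : topologicalType}.

(** A homotopy that is not relative to the boundary of the cube: the whole
    boundary moves along the path [g]. *)
Definition homotopic_along (x y : X) (g : unit_itv R -> X) (f : nloop R n x)
    (f' : nloop R n y) : Prop :=
  exists H : cube R n * unit_itv R -> X,
    [/\ continuous H,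
        forall t, H (t, clamp 0) = f t,
        forall t, H (t, clamp 1) = f' t &
        forall t s, cube_boundary t -> H (t, s) = g s].

Lemma homotopic_along_flip (x y : X) (g : unit_itv R -> X) (f : nloop R n x)
    (f' : nloop R n y) :
  homotopic_along g f f' -> homotopic_along (g \o flip) f' f.
Proof.
move=> [H [cH H0 H1 Hb]]; exists (fun p => H (p.1, flip p.2)); split => [|t|t|t s bt].
- apply: comp_continuous cH; apply: (pair_continuous fst_continuous).
  exact: comp_continuous snd_continuous flip_continuous.
- by rewrite flip0 H1.
- by rewrite flip1 H0.
- exact: Hb.
Qed.

Context {x y : X}.
Implicit Types (g : unit_path R x y) (f : nloop R n x).

Lemma transport_subproof g f :
  continuous (collar 2 f g) /\
  forall t, cube_boundary t -> collar 2 f g t = y.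
Proof.
have fg t : cube_boundary t -> f t = g (clamp 0).
  by move=> bt; rewrite path0 loop_boundary.
split=> [|t bt].
  apply: (@collar_continuous _ _ _ _ (cst 2) (fun=> f) (fun=> g) id) => //.
  - exact: cst_continuous.
  - by move=> b cb; exact: comp_continuous cb (loop_continuous f).
  - by move=> b cb; exact: comp_continuous cb (@path_continuous _ _ _ _ g).
  - by move=> t; exact: cvg_id.
rewrite collar_boundary//; last by lra.
by rewrite (_ : 2 - 1 = 1) ?path1//; lra.
Qed.

Definition transport g f : nloop R n y :=
  let: conj c b := transport_subproof g f in mk_loop c b.

Lemma transportE g f t : transport g f t = collar 2 f g t.
Proof. by rewrite /transport; case: transport_subproof. Qed.

(** Letting the inner cube shrink from ratio [1] to ratio [1 / 2] uncovers the
    collar little by little: at time [s] the boundary of the cube has reached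
    the point [g s]. *)
Lemma homotopic_along_transport g f : homotopic_along g f (transport g f).
Proof.
have cs : continuous (fun p : cube R n * unit_itv R => \val p.2 : R).
  exact: comp_continuous snd_continuous itv01_val_continuous.
exists (fun p => collar (1 + \val p.2) f g p.1); split.
- apply: (@collar_continuous _ _ (cube R n * unit_itv R)%type _
    (fun p => 1 + \val p.2) (fun=> f) (fun=> g) fst).
  + by move=> p; apply: cvgD; [exact: cvg_cst|exact: cs].
  + by move=> p; have := itv01_ge0 p.2; lra.
  + by move=> b cb; exact: comp_continuous cb (loop_continuous f).
  + by move=> b cb; exact: comp_continuous cb (@path_continuous _ _ _ _ g).
  + by move=> _ t bt; rewrite path0 loop_boundary.
  + exact: fst_continuous.
- by move=> t; cbn [fst snd]; rewrite (clamp_le0 (lexx 0)) addr0 collar1.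
- by move=> t; cbn [fst snd]; rewrite (clamp_ge1 (lexx 1)) transportE.
- move=> t s bt; cbn [fst snd]; rewrite collar_boundary//.
  + by rewrite addrC addKr clampK.
  + by rewrite lerDl itv01_ge0.
  + by move=> t' bt'; rewrite path0 loop_boundary.
Qed.

(** The homotopy is run in the inner cube, the collar being the same at all
    times. *)
Lemma transport_homotopic g f f' :
  homotopic f f' -> homotopic (transport g f) (transport g f').
Proof.
move=> [H [cH H0 H1 Hb]].
exists (fun p => collar 2 (fun t => H (t, p.2)) g p.1); split.
- apply: (@collar_continuous _ _ (cube R n * unit_itv R)%type _ (cst 2)
    (fun p t => H (t, p.2)) (fun=> g)) => //.
  + exact: cst_continuous.
  + move=> b cb; apply: comp_continuous cH.
    exact: pair_continuous cb snd_continuous.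
  + by move=> b cb; exact: comp_continuous cb (@path_continuous _ _ _ _ g).
  + by move=> p t bt; rewrite path0 Hb.
  + exact: fst_continuous.
- by move=> t; rewrite transportE; congr collar; apply/funext => s; exact: H0.
- by move=> t; rewrite transportE; congr collar; apply/funext => s; exact: H1.
- move=> t s bt; cbn [fst snd]; rewrite collar_boundary//; first last.
  + by move=> t' bt'; rewrite path0 Hb.
  + by lra.
  + by rewrite (_ : 2 - 1 = 1) ?path1//; lra.
Qed.

(** A subbasic condition on [transport g f] over a compact set [K] splits into a
    condition on [g] alone and one on [f] over the compact set [stretch 2] of
    the part of [K] in the inner cube. *)
Lemma transport_continuous g : continuous (transport g).
Proof.
apply: continuous_comp_initial => f.
have ? := fmap_filter (\val \o transport g) (nbhs_filter f).
apply/compact_open_cvgP => K U cK oU fKU.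
pose A : set (cube R n) := [set t | 2 * center_dist t <= 1].
have cA : closed A.
  have cr : continuous (fun t : cube R n => 2 * center_dist t).
    apply: (@comp_continuous _ R R _ (fun r => 2 * r)).
      exact: center_dist_continuous.
    by move=> r; apply: cvgM; [exact: cvg_cst|exact: cvg_id].
  exact: (closed_comp (fun t _ => cr t) (@closed_le R 1)).
have cS : compact (stretch 2 @` (K `&` A)).
  apply: continuous_compact; last exact: compact_closedI.
  apply: continuous_subspaceT; apply: stretch_continuous.
    exact: cst_continuous.
  by move=> t; exact: cvg_id.
have NfK : nbhs (\val f : {compact-open, cube R n -> X})
    [set h | h @` (stretch 2 @` (K `&` A)) `<=` U].
  apply: open_nbhs_nbhs; split; first exact: compact_open_open.
  move=> _ [_ [t [Kt At] <-] <-]; apply: fKU; exists t => //=.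
  by rewrite -[LHS]/(transport g f t) transportE /collar At.
have cval : continuous (\val : nloop R n x -> {compact-open, cube R n -> X}).
  exact: initial_continuous.
apply: (@filterS _ _ (nbhs_filter f) _ _ _ (cval f _ NfK)) => h /= hU _ [t Kt <-].
rewrite -[X in U X]/(transport g h t) transportE /collar; case: ifPn => At.
  by apply: hU; exists (stretch 2 t) => //; exists t.
apply: fKU; exists t => //.
by rewrite -[LHS]/(transport g f t) transportE /collar (negPf At).
Qed.

End transport.

Section transport_unique.
Context {R : realType} {n : nat} {X : topologicalType} {x y : X}.

(** At time [s] the inner cube carries the stage [s] of the homotopy, whose
    boundary is at [g s], and the collar carries the rest of [g], from [g s]
    to [y].  This deforms [transport g f] into the transport of [f'] along a
    constant path.  The latter is homotopic to [f'], because a homotopy along a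
    constant path is a homotopy relative to the boundary. *)
Lemma homotopic_transport (g : unit_path R x y) (f : nloop R n x)
    (f' : nloop R n y) :
  homotopic_along g f f' -> homotopic (transport g f) f'.
Proof.
move=> [H [cH H0 H1 Hb]].
apply: (@homotopic_trans _ _ _ _ (transport (path_const y) f')); last first.
  exact/homotopic_sym/homotopic_along_transport.
(* [g \o rest s] is the part of [g] after time [s]. *)
pose rest (s u : unit_itv R) : unit_itv R :=
  clamp (\val s + (1 - \val s) * \val u).
have rest1 s : rest s (clamp 1) = clamp 1.
  by rewrite /rest (clamp_ge1 (lexx 1)) mulr1 addrC subrK.
exists (fun p => collar 2 (fun t => H (t, p.2)) (fun u => g (rest p.2 u)) p.1).
split.
- apply: (@collar_continuous _ _ (cube R n * unit_itv R)%type _ (cst 2)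
    (fun p t => H (t, p.2)) (fun p u => g (rest p.2 u))) => //.
  + exact: cst_continuous.
  + move=> b cb; apply: comp_continuous cH.
    exact: pair_continuous cb snd_continuous.
  + move=> b cb; apply: comp_continuous (@path_continuous _ _ _ _ g).
    apply: comp_continuous clamp_continuous.
    have cs : continuous (fun p : cube R n * unit_itv R => \val p.2 : R).
      exact: comp_continuous snd_continuous itv01_val_continuous.
    move=> p; apply: cvgD; first exact: cs.
    apply: cvgM; first by apply: cvgB; [exact: cvg_cst|exact: cs].
    exact: (comp_continuous cb itv01_val_continuous).
  + move=> p t bt; rewrite Hb// /rest (clamp_le0 (lexx 0)) mulr0 addr0.
    by rewrite clampK.
  + exact: fst_continuous.
- move=> t; rewrite transportE; congr collar; apply/funext => u; first exact: H0.
  by rewrite /rest (clamp_le0 (lexx 0)) add0r subr0 mul1r clampK.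
- move=> t; rewrite transportE; congr collar; apply/funext => u; first exact: H1.
  by rewrite /rest (clamp_ge1 (lexx 1)) subrr mul0r addr0 path1.
- move=> t s bt; cbn [fst snd]; rewrite collar_boundary//.
  + by rewrite (_ : 2 - 1 = 1) ?rest1 ?path1//; lra.
  + by lra.
  + move=> t' bt'; rewrite Hb// /rest (clamp_le0 (lexx 0)) mulr0 addr0.
    by rewrite clampK.
Qed.

End transport_unique.

(** * The change-of-basepoint isomorphism *)

Section concat_along.
Context {R : realType} {n : nat} {X : topologicalType} {x y : X}.

(** At each time the two homotopies are concatenated as loops at the point [g s];
    they agree on the common face since both take the value [g s] there. *)
Lemma concat_homotopic_along (g : unit_itv R -> X)
    (f1 f2 : nloop R n.+1 x) (f1' f2' : nloop R n.+1 y) :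
  homotopic_along g f1 f1' -> homotopic_along g f2 f2' ->
  homotopic_along g (concat f1 f2) (concat f1' f2').
Proof.
move=> [H [cH H0 H1 Hb]] [K [cK K0 K1 Kb]].
have cl := last_continuous (@fst_continuous (cube R n.+1) (unit_itv R)).
exists (fun p => concat_fun (fun t => H (t, p.2)) (fun t => K (t, p.2)) p.1).
split.
- apply: paste_continuous => //.
  + apply: comp_continuous cH; apply: (pair_continuous _ snd_continuous).
    apply: (set_last_continuous fst_continuous).
    apply: comp_continuous clamp_continuous => p.
    by apply: cvgM; [exact: cvg_cst|exact: cl].
  + apply: comp_continuous cK; apply: (pair_continuous _ snd_continuous).
    apply: (set_last_continuous fst_continuous).
    apply: comp_continuous clamp_continuous => p.
    apply: cvgB; last exact: cvg_cst.
    by apply: cvgM; [exact: cvg_cst|exact: cl].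
  + move=> p /= ->; rewrite Hb ?Kb//; apply: set_last_boundary1.
    * by left; rewrite clamp_le0//; lra.
    * by right; rewrite clamp_ge1//; lra.
- by move=> t; congr concat_fun; apply/funext => s; [exact: H0|exact: K0].
- by move=> t; congr concat_fun; apply/funext => s; [exact: H1|exact: K1].
- move=> t s bt; apply: concat_fun_boundary bt => t' bt'; [exact: Hb|exact: Kb].
Qed.

End concat_along.

Section base_change.
Context {R : realType} {n : nat} {X : topologicalType} {x y : X}.
Implicit Types g : unit_path R x y.

Definition base_change g (a : homotopy_group R n.+1 x) : homotopy_group R n.+1 y :=
  homotopy_class (transport g (repr a)).

Lemma base_changeE g (f : nloop R n.+1 x) :
  base_change g (homotopy_class f) = homotopy_class (transport g f).
Proof. exact/homotopy_classP/transport_homotopic/repr_homotopic. Qed.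

Lemma base_changeM g : {morph base_change g : a b / (a * b)%g}.
Proof.
apply: homotopy_class_ind => f1; apply: homotopy_class_ind => f2.
rewrite -[(_ * _)%g]/(homotopy_mul _ _) -[RHS]/(homotopy_mul _ _).
rewrite homotopy_mulE !base_changeE homotopy_mulE.
apply/homotopy_classP/homotopic_transport/concat_homotopic_along;
  exact: homotopic_along_transport.
Qed.

Lemma base_change_continuous g : continuous (base_change g).
Proof.
apply/quotient_continuous.
rewrite (_ : _ \o _ = homotopy_class \o transport g); last first.
  by apply/funext => f; exact: base_changeE.
apply: comp_continuous; first exact: transport_continuous.
exact: pi_continuous.
Qed.

End base_change.

(** Run backwards, the homotopy from [f] to [transport g f] goes from
    [transport g f] to [f] along the reversed path, and transport along that
    path is the only end of such a homotopy.  The path [g'] is given up to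
    pointwise equality so that the lemma applies with the roles of a path and
    its reverse exchanged. *)
Lemma base_changeK (R : realType) (n : nat) (X : topologicalType) (x y : X)
    (g : unit_path R x y) (g' : unit_path R y x) :
  g' = g \o flip :> (_ -> _) -> cancel (@base_change R n X x y g) (base_change g').
Proof.
move=> g'E; apply: homotopy_class_ind => f; rewrite !base_changeE.
apply/homotopy_classP/homotopic_transport; rewrite g'E.
exact/homotopic_along_flip/homotopic_along_transport.
Qed.

Theorem theorem2p2 (R : realType) (n : nat) (X : topologicalType) (x y : X)
    (gamma : unit_itv R -> X) (gamma_continuous : continuous gamma)
    (gamma0 : gamma (clamp 0) = x) (gamma1 : gamma (clamp 1) = y) :
  exists (phi : homotopy_group R n.+1 x -> homotopy_group R n.+1 y)
         (psi : homotopy_group R n.+1 y -> homotopy_group R n.+1 x),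
    [/\ {morph phi : a b / (a * b)%g}, cancel phi psi, cancel psi phi,
        continuous phi & continuous psi].
Proof.
pose g := UnitPath gamma_continuous gamma0 gamma1.
exists (base_change g), (base_change (path_rev g)); split.
- exact: base_changeM.
- by apply: base_changeK; apply/funext => u; rewrite path_revE.
- by apply: base_changeK; apply/funext => u; rewrite /= path_revE flipK.
- exact: base_change_continuous.
- exact: base_change_continuous.
Qed.
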